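(* Let $\mu_A,\rho_A,\alpha\in\mathbb{R}$, let $A:\mathbb{R}^n\rightrightarrows\mathbb{R}^n$ and define $T:=A+\alpha\,\mathrm{I}$. (i) Suppose $1+2\rho_A\alpha>0$. Then $T$ is $\Big(\frac{\mu_A+\alpha(1+\rho_A\alpha)}{1+2\rho_A\alpha},\frac{\rho_A}{1+2\rho_A\alpha}\Big)$-semimonotone if and only if $A$ is $(\mu_A,\rho_A)$-semimonotone. The same equivalence holds with ''semimonotone'' replaced on both sides by ''maximally semimonotone''. Moreover, for $(x',y')\in\operatorname{gph}A$, $T$ is $\Big(\frac{\mu_A+\alpha(1+\rho_A\alpha)}{1+2\rho_A\alpha},\frac{\rho_A}{1+2\rho_A\alpha}\Big)$-semimonotone at $(x',y'+\alpha x')\in\operatorname{gph}T$ if and only if $A$ is $(\mu_A,\rho_A)$-semimonotone at $(x',y')$. (ii) Suppose $1+2\rho_A\alpha\le0$. If $A$ is $(\mu_A,\rho_A)$-semimonotone, then $T$ is $(\mu_A+\alpha(1-c\alpha),\rho_A\Box c)$-semimonotone for all $c>-\rho_A$. Likewise, if $A$ is $(\mu_A,\rho_A)$-semimonotone at $(x',y')\in\operatorname{gph}A$, then $T$ is $(\mu_A+\alpha(1-c\alpha),\rho_A\Box c)$-semimonotone at $(x',y'+\alpha x')\in\operatorname{gph}T$ for all $c>-\rho_A$.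
   Context: $\operatorname{gph}A=\{(x,y):y\in Ax\}$; $\mathrm{I}$ is the identity. $A$ is $(\mu,\rho)$-semimonotone at $(x',y')\in\operatorname{gph}A$ if $\langle x-x',y-y'\rangle\ge\mu\|x-x'\|^2+\rho\|y-y'\|^2$ for all $(x,y)\in\operatorname{gph}A$; it is $(\mu,\rho)$-semimonotone if this holds at all $(x',y')\in\operatorname{gph}A$; it is maximally $(\mu,\rho)$-semimonotone if moreover its graph is not strictly contained in the graph of another $(\mu,\rho)$-semimonotone operator. Parallel sum of reals: $a\Box b=\frac{ab}{a+b}$ if $a+b\ne0$ (and $0\Box0=0$). *)

(* Defs.v *)
From HB Require Import structures.
From mathcomp Require Import all_boot all_order all_algebra.
From mathcomp Require Import boolp classical_sets reals.

Set Implicit Arguments.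
Unset Strict Implicit.
Unset Printing Implicit Defensive.

Import Order.TTheory GRing.Theory Num.Theory.
Local Open Scope classical_set_scope.
Local Open Scope ring_scope.

Section Euclidean.
Context {R : realType} {n : nat}.

Definition dotp (x y : 'cV[R]_n) : R := (x^T *m y) 0 0.

(* The norm [`|x|] that MathComp-Analysis puts on matrices is the max norm,
   hence a separate Euclidean norm. *)
Definition enorm (x : 'cV[R]_n) : R := Num.sqrt (dotp x x).

End Euclidean.

Definition setop (R : realType) (n : nat) := 'cV[R]_n -> set 'cV[R]_n.

Section Operators.
Context {R : realType} {n : nat}.
Implicit Types (A B : setop R n) (mu rho a : R).

Definition gph A : set ('cV[R]_n * 'cV[R]_n) := [set p | A p.1 p.2].

Definition op_id : setop R n := fun x => [set x].

Definition op_scale a A : setop R n := fun x => [set a *: y | y in A x].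

Definition op_add A B : setop R n :=
  fun x => [set y + z | y in A x & z in B x].

(* The requirement that the reference point lie in the graph is part of the
   predicate. *)
Definition semimonotone_at mu rho A (p : 'cV[R]_n * 'cV[R]_n) : Prop :=
  gph A p /\
  forall x y, gph A (x, y) ->
    dotp (x - p.1) (y - p.2)
      >= mu * enorm (x - p.1) ^+ 2 + rho * enorm (y - p.2) ^+ 2.

Definition semimonotone mu rho A : Prop :=
  forall p, gph A p -> semimonotone_at mu rho A p.

Definition max_semimonotone mu rho A : Prop :=
  semimonotone mu rho A /\
  ~ exists B, semimonotone mu rho B /\ gph A `<` gph B.

End Operators.

(* Since [x / 0 = 0], this gives [psum 0 0 = 0]; the value is a junk one when
   [a + b = 0] with [a] nonzero. *)
Definition psum {R : realType} (a b : R) : R := a * b / (a + b).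

(* Main.v *)
Require Import Defs.
From HB Require Import structures.
From mathcomp Require Import all_boot all_order all_algebra.
From mathcomp Require Import boolp classical_sets reals.
From mathcomp Require Import ring lra.

(** The map [(x, y) |-> (x, y + alpha *: x)] is a bijection from the graph of
[A] onto the graph of [T = A + alpha I], and it is linear, so it acts on
differences: with [d = x - x'] and [e = y - y'], the difference of the images
is [(d, e + alpha *: d)]. Semimonotonicity is a statement about the quadratic
form [<d, e> - mu |d|^2 - rho |e|^2] on such differences ([semi_pair]), so the
theorem reduces to comparing this form before and after the substitution
[e |-> e + alpha *: d].

When [k = 1 + 2 rho alpha] is positive, the new form with the parameters of
(i) is exactly [k^-1] times the old one ([semi_pair_shift]), whence the two
equivalences. Maximality transfers because the shift is invertible
([shiftK]) and monotone for graph inclusion ([gph_shift_proper]), so that a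
strict extension of one operator is the shift of a strict extension of the
other.

In (ii) the substitution leaves a term [rho |e|^2 + c |alpha d|^2] to be
compared with [(rho c / (rho + c)) |e + alpha d|^2]. Multiplied by [rho + c],
which is positive, the difference is the square [|rho e - c alpha d|^2]
([semi_pair_psum]). *)

Set Implicit Arguments.
Unset Strict Implicit.
Unset Printing Implicit Defensive.

Import Order.TTheory GRing.Theory Num.Theory.
Local Open Scope classical_set_scope.
Local Open Scope ring_scope.

Section EuclideanTheory.
Context {R : realType} {n : nat}.
Implicit Types (x y z : 'cV[R]_n) (a : R).

Lemma dotpC x y : dotp x y = dotp y x.
Proof. by rewrite /dotp -[x^T *m y]trmxK trmx_mul trmxK mxE. Qed.

Lemma dotpDr x y z : dotp x (y + z) = dotp x y + dotp x z.
Proof. by rewrite /dotp mulmxDr mxE. Qed.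

Lemma dotpZr a x y : dotp x (a *: y) = a * dotp x y.
Proof. by rewrite /dotp -scalemxAr mxE. Qed.

Lemma dotpDl x y z : dotp (x + y) z = dotp x z + dotp y z.
Proof. by rewrite dotpC dotpDr !(dotpC z). Qed.

Lemma dotpZl a x y : dotp (a *: x) y = a * dotp x y.
Proof. by rewrite dotpC dotpZr dotpC. Qed.

Lemma dotp_ge0 x : 0 <= dotp x x.
Proof. by rewrite /dotp mxE sumr_ge0 // => i _; rewrite mxE -expr2 sqr_ge0. Qed.

Lemma enorm_sqr x : enorm x ^+ 2 = dotp x x.
Proof. by rewrite sqr_sqrtr // dotp_ge0. Qed.

End EuclideanTheory.

Section SemiPair.
Context {R : realType} {n : nat}.
Implicit Types (mu rho alpha c : R) (d e : 'cV[R]_n).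

Definition semi_pair mu rho d e : Prop :=
  mu * dotp d d + rho * dotp e e <= dotp d e.

(** The right-hand form is [(1 + 2 * rho * alpha)^-1] times the left-hand one:
the cross term [2 * alpha * <d, e>] of [|e + alpha d|^2] rescales [<d, e>],
and the new parameters are chosen to absorb the rest. *)
Lemma semi_pair_shift mu rho alpha d e : 0 < 1 + 2 * rho * alpha ->
  semi_pair mu rho d e <->
  semi_pair ((mu + alpha * (1 + rho * alpha)) / (1 + 2 * rho * alpha))
    (rho / (1 + 2 * rho * alpha)) d (e + alpha *: d).
Proof.
move=> k_gt0; rewrite /semi_pair.
rewrite !(dotpDl, dotpDr, dotpZl, dotpZr) (dotpC e d).
rewrite -[X in is_true X <-> _]subr_ge0 -[X in _ <-> is_true X]subr_ge0.
set p := (X in is_true (0 <= X) <-> _).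
set q := (X in _ <-> is_true (0 <= X)).
have -> : q = p / (1 + 2 * rho * alpha).
  by rewrite /p /q; field; rewrite gt_eqF.
by rewrite pmulr_lge0 ?invr_gt0.
Qed.

(** A weighted parallelogram inequality: after cancelling the terms in [mu] and
[alpha], what remains is [|rho e - c alpha d|^2 / (rho + c) >= 0]. *)
Lemma semi_pair_psum mu rho alpha c d e : - rho < c ->
  semi_pair mu rho d e ->
  semi_pair (mu + alpha * (1 - c * alpha)) (psum rho c) d (e + alpha *: d).
Proof.
move=> ltc; have s_gt0 : 0 < rho + c by lra.
have := dotp_ge0 (rho *: e + (- (c * alpha)) *: d).
rewrite /semi_pair /psum !(dotpDl, dotpDr, dotpZl, dotpZr) (dotpC e d).
set q := (X in 0 <= X -> _) => q_ge0 hde.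
have qs_ge0 : 0 <= q / (rho + c) by rewrite divr_ge0 // ltW.
rewrite -subr_ge0; set r := (X in 0 <= X).
have -> : r = (dotp d e - (mu * dotp d d + rho * dotp e e)) + q / (rho + c).
  by rewrite /q /r; field; rewrite gt_eqF.
by rewrite addr_ge0 ?subr_ge0.
Qed.

End SemiPair.

Section Shift.
Context {R : realType} {n : nat}.
Implicit Types (A B : setop R n) (mu rho alpha : R).

Definition shift alpha A : setop R n := op_add A (op_scale alpha op_id).

Lemma shiftE alpha A x y : shift alpha A x y <-> A x (y - alpha *: x).
Proof.
split=> [[u Au [_ [_ -> <-] <-]]|Axy]; first by rewrite addrK.
exists (y - alpha *: x) => //; exists (alpha *: x); last by rewrite subrK.
by exists x.
Qed.

Lemma gph_shiftD alpha A x y :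
  gph (shift alpha A) (x, y + alpha *: x) <-> gph A (x, y).
Proof. by rewrite /gph /= shiftE addrK. Qed.

Lemma shiftK alpha A : shift alpha (shift (- alpha) A) = A.
Proof.
apply/funext => x; apply/seteqP; split=> y; rewrite !shiftE.
all: by rewrite scaleNr opprK subrK.
Qed.

Lemma gph_shift_subset alpha A B :
  gph (shift alpha A) `<=` gph (shift alpha B) <-> gph A `<=` gph B.
Proof.
split=> sub [x y].
  by move=> /(gph_shiftD alpha) /sub /gph_shiftD.
by rewrite -[y](subrK (alpha *: x)) => /gph_shiftD /sub /gph_shiftD.
Qed.

Lemma gph_shift_proper alpha A B :
  gph (shift alpha A) `<` gph (shift alpha B) <-> gph A `<` gph B.
Proof. by rewrite /proper !gph_shift_subset. Qed.

Lemma semimonotone_atE mu rho A p :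
  semimonotone_at mu rho A p <->
  gph A p /\
  forall x y, gph A (x, y) -> semi_pair mu rho (x - p.1) (y - p.2).
Proof.
rewrite /semimonotone_at /semi_pair; split=> -[Ap ineq]; split=> // x y Axy.
  by rewrite -!enorm_sqr ineq.
by rewrite !enorm_sqr ineq.
Qed.

(** Differences of points of the shifted graph are the images under
[(d, e) |-> (d, e + alpha *: d)] of differences of points of the graph. *)
Lemma semimonotone_at_shiftE mu rho alpha A x' y' :
  semimonotone_at mu rho (shift alpha A) (x', y' + alpha *: x') <->
  gph A (x', y') /\
  forall x y, gph A (x, y) ->
    semi_pair mu rho (x - x') ((y - y') + alpha *: (x - x')).
Proof.
have diffE (x y : 'cV[R]_n) :
    y + alpha *: x - (y' + alpha *: x') = (y - y') + alpha *: (x - x').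
  by rewrite scalerBr opprD addrACA.
rewrite semimonotone_atE gph_shiftD; split=> -[Ap ineq]; split=> // x y.
  by move=> /(gph_shiftD alpha)/ineq; rewrite /= diffE.
rewrite -[y](subrK (alpha *: x)) => /gph_shiftD/ineq.
by rewrite /= -diffE.
Qed.

Lemma semimonotone_shiftE mu rho alpha A :
  semimonotone mu rho (shift alpha A) <->
  forall x' y', gph A (x', y') ->
    semimonotone_at mu rho (shift alpha A) (x', y' + alpha *: x').
Proof.
split=> [mono x' y' Ap|mono [x' y']]; first exact/mono/gph_shiftD.
by rewrite -[y'](subrK (alpha *: x')) => /gph_shiftD/mono.
Qed.

Lemma semimonotone_at_shift mu rho alpha A x' y' : 0 < 1 + 2 * rho * alpha ->
  semimonotone_at ((mu + alpha * (1 + rho * alpha)) / (1 + 2 * rho * alpha))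
    (rho / (1 + 2 * rho * alpha)) (shift alpha A) (x', y' + alpha *: x') <->
  semimonotone_at mu rho A (x', y').
Proof.
move=> k_gt0; rewrite semimonotone_at_shiftE semimonotone_atE.
by split=> -[Ap ineq]; split=> // x y /ineq /(semi_pair_shift _ _ _ k_gt0).
Qed.

Lemma semimonotone_shift mu rho alpha A : 0 < 1 + 2 * rho * alpha ->
  semimonotone ((mu + alpha * (1 + rho * alpha)) / (1 + 2 * rho * alpha))
    (rho / (1 + 2 * rho * alpha)) (shift alpha A) <->
  semimonotone mu rho A.
Proof.
move=> k_gt0; rewrite semimonotone_shiftE; split=> mono.
  by move=> [x' y'] /mono /(semimonotone_at_shift _ _ _ _ k_gt0).
by move=> x' y' /mono /(semimonotone_at_shift _ _ _ _ k_gt0).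
Qed.

(** Shifting is a bijection on operators which preserves both semimonotonicity
and strict inclusion of graphs, so it matches the strict semimonotone
extensions of [A] with those of its shift. *)
Lemma max_semimonotone_shift mu rho alpha A : 0 < 1 + 2 * rho * alpha ->
  max_semimonotone ((mu + alpha * (1 + rho * alpha)) / (1 + 2 * rho * alpha))
    (rho / (1 + 2 * rho * alpha)) (shift alpha A) <->
  max_semimonotone mu rho A.
Proof.
move=> k_gt0; rewrite /max_semimonotone (semimonotone_shift _ _ k_gt0).
split=> -[mono nomax]; split=> // -[B [monoB ltB]]; apply: nomax.
  by exists (shift alpha B); rewrite semimonotone_shift // gph_shift_proper.
exists (shift (- alpha) B).
by rewrite -(semimonotone_shift _ _ k_gt0) -(gph_shift_proper alpha) shiftK.
Qed.

Lemma semimonotone_at_psum mu rho alpha c A x' y' : - rho < c ->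
  semimonotone_at mu rho A (x', y') ->
  semimonotone_at (mu + alpha * (1 - c * alpha)) (psum rho c)
    (shift alpha A) (x', y' + alpha *: x').
Proof.
move=> ltc; rewrite semimonotone_at_shiftE semimonotone_atE.
by move=> -[Ap ineq]; split=> // x y /ineq /(semi_pair_psum _ ltc).
Qed.

End Shift.

Theorem proposition4p8 (R : realType) (n : nat) (muA rhoA alpha : R)
    (A : setop R n) :
  let T := op_add A (op_scale alpha op_id) in
  (0 < 1 + 2 * rhoA * alpha ->
    let muT := (muA + alpha * (1 + rhoA * alpha)) / (1 + 2 * rhoA * alpha) in
    let rhoT := rhoA / (1 + 2 * rhoA * alpha) in
    [/\ semimonotone muT rhoT T <-> semimonotone muA rhoA A,
        max_semimonotone muT rhoT T <-> max_semimonotone muA rhoA A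
      & forall x' y' : 'cV[R]_n, gph A (x', y') ->
          gph T (x', y' + alpha *: x') /\
          (semimonotone_at muT rhoT T (x', y' + alpha *: x') <->
           semimonotone_at muA rhoA A (x', y'))]) /\
  (1 + 2 * rhoA * alpha <= 0 ->
    (semimonotone muA rhoA A ->
      forall c : R, - rhoA < c ->
        semimonotone (muA + alpha * (1 - c * alpha)) (psum rhoA c) T) /\
    (forall x' y' : 'cV[R]_n, gph A (x', y') ->
      semimonotone_at muA rhoA A (x', y') ->
      forall c : R, - rhoA < c ->
        semimonotone_at (muA + alpha * (1 - c * alpha)) (psum rhoA c) T
          (x', y' + alpha *: x'))).
Proof.
move=> T; split=> [k_gt0 muT rhoT|_]; first split.
- exact: semimonotone_shift.
- exact: max_semimonotone_shift.
- by move=> x' y' Ap; split; [exact/gph_shiftD|exact: semimonotone_at_shift].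
split=> [mono c ltc|x' y' _ mono_at c ltc]; last exact: semimonotone_at_psum.
by apply/semimonotone_shiftE => x' y' /mono; exact: semimonotone_at_psum.
Qed.
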